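(* Let $(M,F)$ be a Finsler manifold, $\mathbf B$ a $\pi$-form (of degree one) independent of the directional argument $y$, $\mathfrak B:=\mathbf B(\overline\eta)$, and let $$\widetilde F=\frac{\mathfrak B^2}{F}-F-\mathfrak B$$ be the golden Finsler metric. Put $$C_1:=\frac{(\mathfrak B^2+F^2)(-\mathfrak B^2+\mathfrak BF+F^2)}{F^4},\quad C_2:=\frac{F^3-4\mathfrak B^3+3\mathfrak B^2F}{F^3},\quad C_3:=\frac{6\mathfrak B^2-6\mathfrak BF-F^2}{F^2}.$$ Then for all $\pi$-vector fields $\overline X,\overline Y,\overline Z$: (a) the metric tensor $\widetilde g$ of $\widetilde F$ is $$\widetilde g(\overline X,\overline Y)=C_1\,g(\overline X,\overline Y)-\frac{\mathfrak B}{F}C_2\,\ell(\overline X)\ell(\overline Y)+C_3\,\mathbf B(\overline X)\mathbf B(\overline Y)+C_2\{\mathbf B(\overline X)\ell(\overline Y)+\mathbf B(\overline Y)\ell(\overline X)\};$$ (b) the Cartan tensor $\widetilde{\mathbf T}$ of $\widetilde F$ is given by $$\begin{aligned}2\widetilde{\mathbf T}(\overline X,\overline Y,\overline Z)={}&2C_1\,\mathbf T(\overline X,\overline Y,\overline Z)-\frac{\mathfrak B\,C_2}{F^2}\{\hbar(\overline X,\overline Z)\ell(\overline Y)+\hbar(\overline Y,\overline Z)\ell(\overline X)\}\\&+\frac{C_2}{F}\{\mathbf B(\overline X)\hbar(\overline Y,\overline Z)+\mathbf B(\overline Y)\hbar(\overline X,\overline Z)\}\\&+(D^\circ_{\gamma\overline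 Z}C_1)\,g(\overline X,\overline Y)+(D^\circ_{\gamma\overline Z}C_3)\,\mathbf B(\overline X)\mathbf B(\overline Y)\\&-\Big(D^\circ_{\gamma\overline Z}\Big[\frac{\mathfrak B}{F}C_2\Big]\Big)\ell(\overline X)\ell(\overline Y)+(D^\circ_{\gamma\overline Z}C_2)\{\mathbf B(\overline X)\ell(\overline Y)+\mathbf B(\overline Y)\ell(\overline X)\}.\end{aligned}$$
   Context: $\pi:TM\to M$ is the tangent bundle; $\pi$-vector fields (barred letters) are sections of the pullback bundle $\pi^{-1}(TM)$, and a $\pi$-form of degree one is a section of its dual. $\gamma:\pi^{-1}(TM)\to TTM$ is the natural injection onto the vertical bundle (vertical lift), $\rho=(\pi_{TM},d\pi):TTM\to\pi^{-1}(TM)$, $J=\gamma\circ\rho$ the vertical endomorphism, $d_Jf=df\circ J$, and $\overline\eta(u)=(u,u)$ the fundamental $\pi$-vector field. A Finsler metric $F:TM\to[0,\infty)$ is continuous, smooth and positive off the zero section, positively homogeneous of degree $1$ in $y$, with $\Omega=\frac12dd_JF^2$ of maximal rank; its metric tensor is $g(\rho X,\rho Y)=\Omega(JX,Y)$, i.e. $g_{ij}=\frac12\frac{\partial^2F^2}{\partial y^i\partial y^j}$. A conic Finsler metric satisfies these conditions on an open conic subset of the slit tangent bundle; the golden metric $\widetilde F$ is taken on a conic domain where it is such a metric. $D^\circ$ is the Berwald connection of $F$ on $\pi^{-1}(TM)$; $D^\circ_{\gamma\overline X}$ acts in natural coordinates as the partial derivative $\overline X^i\partial/\partial y^i$ on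 components, and on functions $D^\circ_{\gamma\overline X}f=df(\gamma\overline X)$. A $\pi$-form is independent of $y$ if $D^\circ_{\gamma\overline U}\mathbf B=0$ for all $\overline U$. Further $\ell(\overline X)=F^{-1}g(\overline\eta,\overline X)$, $\hbar=g-\ell\otimes\ell$ is the angular metric tensor, and $\mathbf T$ is the Cartan tensor, $2\mathbf T(\overline X,\overline Y,\overline Z)=(D^\circ_{\gamma\overline X}g)(\overline Y,\overline Z)$ (totally symmetric). Tildes denote the same objects for $\widetilde F$. *)

(* Defs.v *)
From HB Require Import structures.
From mathcomp Require Import all_boot all_order all_algebra.
From mathcomp Require Import all_classical all_reals all_analysis.

Set Implicit Arguments.
Unset Strict Implicit.
Unset Printing Implicit Defensive.
Import Order.TTheory GRing.Theory Num.Theory.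
Import numFieldNormedType.Exports.

Local Open Scope classical_set_scope.
Local Open Scope ring_scope.

(** * Smooth maps between open subsets of normed spaces *)

Fixpoint Ck (R : realType) (V W : normedModType R) (k : nat) (U : set V)
    (f : V -> W) : Prop :=
  if k is k'.+1 then
    (forall x, U x -> differentiable f x) /\
    (forall v, Ck k' U ('D_v f))
  else forall x, U x -> {for x, continuous f}.

Definition smooth_on (R : realType) (V W : normedModType R) (U : set V)
    (f : V -> W) : Prop :=
  forall k, Ck k U f.

(** * Smooth manifolds *)

(* [crd] and [par] are total functions; only their restrictions to [dom] and
   to [crd @` dom], where they are mutually inverse, are meaningful. *)
Record chart (R : realType) (n : nat) (M : topologicalType) := Chart {
  dom : set M;
  crd : M -> 'rV[R]_n;
  par : 'rV[R]_n -> M;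
  dom_open : open dom;
  img_open : open (crd @` dom);
  crdK : forall x, dom x -> par (crd x) = x;
  crd_cts : forall x, dom x -> {for x, continuous crd};
  par_cts : forall p, (crd @` dom) p -> {for p, continuous par}
}.

Record manifold (R : realType) (n : nat) := Manifold {
  carrier :> topologicalType;
  idx : Type;
  atlas : idx -> chart R n carrier;
  atlas_cover : forall x, exists a, dom (atlas a) x;
  atlas_smooth : forall a b,
    smooth_on (crd (atlas a) @` (dom (atlas a) `&` dom (atlas b)))
              (crd (atlas b) \o par (atlas a));
  manifold_hausdorff : hausdorff_space carrier;
  manifold_second_countable : @second_countable carrier
}.

(** * Tangent vectors *)

Lemma derive_comp_at (R : realType) (U V W : normedModType R) (f : U -> V)
    (g : V -> W) (x : U) (z : V) (v : U) :
  f x = z -> differentiable f x -> differentiable g z ->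
  'd g z ('d f x v) = 'D_v (g \o f) x.
Proof.
move=> <- df dg; rewrite (deriveE v (differentiable_comp df dg)).
by apply/esym; exact: (congr1 (fun h : U -> W => h v) (diff_comp df dg)).
Qed.

Section Tangent.
Context {R : realType} {n : nat} {M : manifold R n}.
Implicit Types (x : M) (a b c : idx M).

Definition transition a b : 'rV[R]_n -> 'rV[R]_n :=
  crd (atlas b) \o par (atlas a).

(* A tangent vector at [x] is the family of its component vectors in all the
   charts around [x], which are related by the differentials of the transition
   maps.  The components in the other charts are set to [0], so that equal
   vectors are Leibniz-equal. *)
Definition tangent_pred x : {pred (idx M -> 'rV[R]_n)} :=
  [pred v | `[< (forall a b, dom (atlas a) x -> dom (atlas b) x ->
                   v b = 'd (transition a b) (crd (atlas a) x) (v a)) /\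
                (forall a, ~ dom (atlas a) x -> v a = 0) >]].

Fact tangent_submod_closed x : submod_closed (tangent_pred x).
Proof.
split=> [|k v w].
  by apply/asboolP; split=> // a b _ _; rewrite linear0.
move=> /asboolP[vT v0] /asboolP[wT w0]; apply/asboolP; split=> [a b xa xb|a xa].
  rewrite -[(k *: v + w) b]/(k *: v b + w b).
  by rewrite (vT _ _ xa xb) (wT _ _ xa xb) -linearP.
by rewrite -[(k *: v + w) a]/(k *: v a + w a) v0 ?w0 // scaler0 addr0.
Qed.

HB.instance Definition _ x :=
  GRing.isSubmodClosed.Build R (idx M -> 'rV[R]_n) (tangent_pred x)
    (tangent_submod_closed x).

Record tangent x := Tangent {
  components :> idx M -> 'rV[R]_n;
  _ : components \in tangent_pred x
}.

HB.instance Definition _ x := [isSub for @components x].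
HB.instance Definition _ x := [Choice of tangent x by <:].
HB.instance Definition _ x :=
  [SubChoice_isSubLmodule of tangent x by <:].

Lemma tangentP x (v : tangent x) :
  (forall a b, dom (atlas a) x -> dom (atlas b) x ->
     v b = 'd (transition a b) (crd (atlas a) x) (v a)) /\
  (forall a, ~ dom (atlas a) x -> v a = 0).
Proof. by case: v => v /= /asboolP. Qed.

Lemma tangent_eq x a (v w : tangent x) : dom (atlas a) x -> v a = w a -> v = w.
Proof.
move=> xa vw; apply: val_inj; apply/funext => b /=.
have [[vT v0] [wT w0]] := (tangentP v, tangentP w).
have [xb|xb] := pselect (dom (atlas b) x); last by rewrite v0 ?w0.
by rewrite (vT a b) // (wT a b) // vw.
Qed.

Lemma transition_differentiable a b x : dom (atlas a) x -> dom (atlas b) x ->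
  differentiable (transition a b) (crd (atlas a) x).
Proof.
by move=> xa xb; apply: (proj1 (atlas_smooth a b 1%N)); exists x.
Qed.

Lemma near_dom a b x : dom (atlas a) x -> dom (atlas b) x ->
  \forall p \near crd (atlas a) x, dom (atlas b) (par (atlas a) p).
Proof.
move=> xa xb; apply: (par_cts (c := atlas a)); first by exists x.
rewrite crdK //; apply: open_nbhs_nbhs; split=> //; exact: dom_open.
Qed.

Lemma transition_comp a b c x (y : 'rV[R]_n) :
  dom (atlas a) x -> dom (atlas b) x -> dom (atlas c) x ->
  'd (transition b c) (crd (atlas b) x) ('d (transition a b) (crd (atlas a) x) y)
  = 'd (transition a c) (crd (atlas a) x) y.
Proof.
move=> xa xb xc.
have dab := transition_differentiable xa xb.
have dbc := transition_differentiable xb xc.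
have dac := transition_differentiable xa xc.
have Eb : transition a b (crd (atlas a) x) = crd (atlas b) x.
  by rewrite /transition /= crdK.
have E1 := @derive_comp_at _ _ _ _ (transition a b) (transition b c) _ _ y Eb dab dbc.
have E2 := deriveE y dac.
apply: (etrans E1); apply: (etrans _ E2).
apply: near_eq_derive; near=> p; rewrite /transition /= crdK //.
by near: p; exact: near_dom.
Unshelve. all: by end_near. Qed.

(* The tangent vector at [x] with components [y] in the chart [a]; it exists
   as soon as [a] is a chart around [x], by [tangent_ofK]. *)
Definition tangent_of a x (y : 'rV[R]_n) : tangent x :=
  xget 0 [set v : tangent x | v a = y].

Lemma tangent_ofK a x (y : 'rV[R]_n) : dom (atlas a) x -> tangent_of a x y a = y.
Proof.
move=> xa; suff [v vy] : exists v : tangent x, v a = y.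
  by rewrite /tangent_of; case: xgetP => [w _ ->//|/(_ v)].
have vP : (fun b => if pselect (dom (atlas b) x)
             then 'd (transition a b) (crd (atlas a) x) y else 0)
          \in tangent_pred x.
  apply/asboolP; split=> [b c xb xc|b xb]; last by case: pselect.
  case: pselect => // xb'; case: pselect => // xc'.
  by apply/esym; exact: transition_comp.
exists (Tangent vP) => /=; case: pselect => // xa'.
have dT := transition_differentiable xa xa.
apply: (etrans (esym (deriveE y dT))).
have dI : 'D_y id (crd (atlas a) x) = y by exact: derive_id.
apply: (etrans _ dI).
apply: near_eq_derive; near=> p; rewrite /transition /=.
have [z za <-] : (crd (atlas a) @` dom (atlas a)) p.
  near: p; apply: open_nbhs_nbhs; split; [exact: img_open | by exists x].
by rewrite crdK.
Unshelve. all: by end_near. Qed.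

End Tangent.
Arguments tangent {R n M} x.

(* In this section the base point [x] is always an explicit argument. *)
Unset Implicit Arguments.

Section TangentBundle.
Context {R : realType} {n : nat} {M : manifold R n}.
Implicit Types (x : M) (a b : idx M).

(* Natural coordinates on [TM]: a point of the chart of [TM] induced by [a] is
   written [p = row_mx x y], with [x] the base point and [y] the components. *)
Definition base_of a (p : 'rV[R]_(n + n)) : M := par (atlas a) (lsubmx p).
Definition vect_of a (p : 'rV[R]_(n + n)) : tangent (base_of a p) :=
  tangent_of a (base_of a p) (rsubmx p).

(* Subsets of [TM], functions on [TM], sections of the pullback bundle, and
   sections of its dual; [X x u] is the value at the point [u] of [TM] over
   [x].  Only tensorial expressions in [pi]-vector fields are formed below, so
   these are arbitrary sections, with no smoothness required. *)
Definition tm_set := forall x : M, set (tangent x).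
Definition tm_fun := forall x : M, tangent x -> R.
Definition pi_field := forall x : M, tangent x -> tangent x.
Definition pi_form := forall x : M, tangent x -> {scalar (tangent x)}.

Definition slit : tm_set := fun x => [set u | u <> 0].
Definition tm_full : tm_set := fun x => setT.

Definition nat_set a (D : tm_set) : set 'rV[R]_(n + n) :=
  [set p | (crd (atlas a) @` dom (atlas a)) (lsubmx p) /\
           D (base_of a p) (vect_of a p)].
Definition nat_fun a (f : tm_fun) : 'rV[R]_(n + n) -> R :=
  fun p => f (base_of a p) (vect_of a p).

Definition tm_open (D : tm_set) : Prop := forall a, open (nat_set a D).
Definition tm_continuous (f : tm_fun) : Prop :=
  forall a p, nat_set a tm_full p -> {for p, continuous (nat_fun a f)}.
Definition tm_smooth (D : tm_set) (f : tm_fun) : Prop :=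
  forall a, smooth_on (nat_set a D) (nat_fun a f).

(* A [pi]-form is smooth when its values on the natural frame fields, hence on
   every field [w] with constant natural components, are smooth. *)
Definition pi_form_smooth (D : tm_set) (B : pi_form) : Prop :=
  forall a (w : 'rV[R]_n),
    smooth_on (nat_set a D)
      (fun p => B (base_of a p) (vect_of a p) (tangent_of a (base_of a p) w)).

(** * Vertical differentiation and the Berwald connection *)

(* [d f (gamma w)] at [u], where [gamma w] is the velocity at [t = 0] of the
   curve [u + t w] in the fibre. *)
Definition vderiv {x} (f : tangent x -> R) (u w : tangent x) : R :=
  derive1 (fun t : R => f (u + t *: w)) 0.

(* In natural coordinates [D°_{gamma U}] is the derivative [U^i d/dy^i] of the
   components, whatever the Finsler metric; the arguments of a tensor are
   therefore frozen at the point of evaluation. *)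
Definition berwald_fun (U : pi_field) (f : tm_fun) : tm_fun :=
  fun x u => vderiv (f x) u (U x u).

(* [(D°_{gamma U} B)(Y)]. *)
Definition berwald_form (U : pi_field) (B : pi_form) (Y : pi_field) : tm_fun :=
  fun x u => vderiv (fun v => B x v (Y x u)) u (U x u).

(* Covariant 2-tensor fields on the pullback bundle, and
   [(D°_{gamma U} g)(Y, Z)]. *)
Definition pi_tensor2 := forall x : M, tangent x -> tangent x -> tangent x -> R.
Definition berwald_tensor2 (U : pi_field) (g : pi_tensor2) (Y Z : pi_field) :
    tm_fun :=
  fun x u => vderiv (fun v => g x v (Y x u) (Z x u)) u (U x u).

Definition independent_of_y (B : pi_form) : Prop :=
  forall (U Y : pi_field) x u, slit x u -> berwald_form U B Y x u = 0.

(** * Finsler metrics *)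

(* [J], [d_J f = df o J] and the exterior derivative of a 1-form, in natural
   coordinates.  In [ext_d], [theta q xi] is the value at [q] of the 1-form
   [theta] on [xi], and [xi], [eta] are constant vector fields. *)
Definition vertJ (xi : 'rV[R]_(n + n)) : 'rV[R]_(n + n) := row_mx 0 (lsubmx xi).
Definition dJ (f : 'rV[R]_(n + n) -> R) (q xi : 'rV[R]_(n + n)) : R :=
  'd f q (vertJ xi).
Definition ext_d (theta : 'rV[R]_(n + n) -> 'rV[R]_(n + n) -> R)
    (q xi eta : 'rV[R]_(n + n)) : R :=
  'D_xi (theta ^~ eta) q - 'D_eta (theta ^~ xi) q.

Definition Omega (F : tm_fun) a (p xi eta : 'rV[R]_(n + n)) : R :=
  2^-1 * ext_d (dJ (fun q => nat_fun a F q ^+ 2)) p xi eta.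
Definition Omega_mx (F : tm_fun) a (p : 'rV[R]_(n + n)) : 'M[R]_(n + n) :=
  \matrix_(i, j) Omega F a p (delta_mx 0 i) (delta_mx 0 j).

Definition pos_homogeneous (D : tm_set) (F : tm_fun) : Prop :=
  forall x (u : tangent x) (k : R), D x u -> 0 < k -> F x (k *: u) = k * F x u.

Definition finsler_on (D : tm_set) (F : tm_fun) : Prop :=
  [/\ tm_smooth D F,
      forall x u, D x u -> 0 < F x u,
      pos_homogeneous D F &
      forall a p, nat_set a D p -> \rank (Omega_mx F a p) = (n + n)%N].

Definition finsler_metric (F : tm_fun) : Prop :=
  [/\ forall x u, 0 <= F x u,
      tm_continuous F,
      pos_homogeneous tm_full F &
      finsler_on slit F].

Definition conic_domain (D : tm_set) : Prop :=
  [/\ tm_open D,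
      forall x u, D x u -> slit x u &
      forall x (u : tangent x) (k : R), D x u -> 0 < k -> D x (k *: u)].

Definition conic_finsler_metric (D : tm_set) (F : tm_fun) : Prop :=
  conic_domain D /\ finsler_on D F.

(* [g_ij = 1/2 d^2 F^2 / dy^i dy^j]; see [metricE] for [g(rho X, rho Y) =
   Omega(J X, Y)]. *)
Definition metric (F : tm_fun) : pi_tensor2 := fun x u X Y =>
  2^-1 * vderiv (fun v => vderiv (fun w => F x w ^+ 2) v Y) u X.

Definition ell (F : tm_fun) : forall x : M, tangent x -> tangent x -> R :=
  fun x u X => (F x u)^-1 * metric F x u u X.
Definition angular (F : tm_fun) : pi_tensor2 := fun x u X Y =>
  metric F x u X Y - ell F x u X * ell F x u Y.
Definition cartan (F : tm_fun) (X Y Z : pi_field) : tm_fun := fun x u =>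
  2^-1 * berwald_tensor2 X (metric F) Y Z x u.

(** * The golden metric *)

Section Golden.
Variables (F : tm_fun) (B : pi_form).

Definition frakB : tm_fun := fun x u => B x u u.

Definition golden : tm_fun := fun x u =>
  frakB x u ^+ 2 / F x u - F x u - frakB x u.

Definition C1 : tm_fun := fun x u =>
  (frakB x u ^+ 2 + F x u ^+ 2) * (- frakB x u ^+ 2 + frakB x u * F x u + F x u ^+ 2)
  / F x u ^+ 4.
Definition C2 : tm_fun := fun x u =>
  (F x u ^+ 3 - 4 * frakB x u ^+ 3 + 3 * frakB x u ^+ 2 * F x u) / F x u ^+ 3.
Definition C3 : tm_fun := fun x u =>
  (6 * frakB x u ^+ 2 - 6 * frakB x u * F x u - F x u ^+ 2) / F x u ^+ 2.

End Golden.

End TangentBundle.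

Arguments tm_fun {R n} M.
Arguments tm_set {R n} M.
Arguments pi_field {R n} M.
Arguments pi_form {R n} M.

(** * The metric tensor in terms of [Omega] *)

Section MetricOmega.
Context {R : realType} {n : nat} {M : manifold R n}.

Lemma vect_ofD (a : idx M) (p : 'rV[R]_(n + n)) (t : R) (X : tangent (base_of a p)) :
  (crd (atlas a) @` dom (atlas a)) (lsubmx p) ->
  forall f : tm_fun M,
  nat_fun a f (p + t *: row_mx 0 (X a)) = f (base_of a p) (vect_of a p + t *: X).
Proof.
move=> [z za zp] f; rewrite /nat_fun /vect_of.
have -> : base_of a (p + t *: row_mx 0 (X a)) = base_of a p.
  by rewrite /base_of !linearE /= row_mxKl scaler0 addr0.
congr (f _ _); have pa : dom (atlas a) (base_of a p).
  by rewrite /base_of -zp crdK.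
apply: (tangent_eq pa); rewrite tangent_ofK //.
rewrite linearD linearZ /= row_mxKr.
rewrite -[RHS]/((tangent_of a (base_of a p) (rsubmx p)) a + t *: X a).
by rewrite tangent_ofK.
Qed.

Lemma derive_line (V : normedModType R) (f : V -> R) (p v : V) :
  'D_v f p = derive1 (fun t : R => f (p + t *: v)) 0.
Proof.
rewrite /derive /derive1; congr (lim (_ @ 0^')); apply/funext => h /=.
by rewrite addr0 scale0r addr0 (addrC p).
Qed.

Lemma metricE (D : tm_set M) (F : tm_fun M) (a : idx M) (p xi eta : 'rV[R]_(n + n))
    (X Y : tangent (base_of a p)) :
  tm_open D -> tm_smooth D F -> nat_set a D p ->
  lsubmx xi = X a -> lsubmx eta = Y a ->
  metric F (base_of a p) (vect_of a p) X Y = Omega F a p (vertJ xi) eta.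
Proof.
move=> Do Fs pD xiX etaY; have [pI _] := pD.
rewrite /metric /Omega /ext_d /dJ; congr (_ * _).
have JJ : vertJ (vertJ xi) = 0 by rewrite /vertJ row_mxKl row_mx0.
have -> : (fun q => 'd (fun r => nat_fun a F r ^+ 2) q (vertJ (vertJ xi)))
          = cst 0.
  by apply/funext => q; rewrite JJ linear0.
have -> : 'D_eta (cst (0 : R)) p = 0 by exact: derive_cst.
rewrite subr0 derive_line /vderiv !derive1E; apply: near_eq_derive.
have Dp : \forall q \near p, nat_set a D q by apply: open_nbhs_nbhs; split.
have cl : (fun t : R => p + t *: vertJ xi) @ 0 --> p.
  rewrite -[X in _ --> X]addr0 -[X in _ + X](scale0r (vertJ xi)).
  by apply: cvgD; [exact: cvg_cst | apply: cvgZr_tmp; exact: cvg_id].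
near=> t => /=.
have tD : nat_set a D (p + t *: vertJ xi) by near: t; exact: (cl _ Dp).
have dF : differentiable (fun r => nat_fun a F r ^+ 2) (p + t *: vertJ xi).
  have dF1 : differentiable (nat_fun a F) (p + t *: vertJ xi).
    exact: (proj1 (Fs a 1%N)).
  exact: (differentiableM dF1 dF1).
rewrite -deriveE // derive_line; congr (derive1 _ 0); apply/funext => s.
rewrite /vertJ xiX etaY -(addrA p).
have -> : t *: row_mx 0 (X a) + s *: row_mx 0 (Y a)
          = 1 *: row_mx 0 ((t *: X + s *: Y) a) :> 'rV[R]_(n + n).
  rewrite scale1r -[(_ + _ : tangent _) a]/(t *: X a + s *: Y a).
  by rewrite !scale_row_mx add_row_mx !scaler0 addr0.
by rewrite vect_ofD // scale1r addrA.
Unshelve. all: by end_near. Qed.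
End MetricOmega.

(* Main.v *)
Require Import Defs.
From mathcomp Require Import all_boot all_order all_algebra.
From mathcomp Require Import all_classical all_reals all_analysis.
From mathcomp Require Import ring lra.

Set Implicit Arguments.
Unset Strict Implicit.
Unset Printing Implicit Defensive.

Import Order.TTheory GRing.Theory Num.Theory.
Import numFieldNormedType.Exports.
Local Open Scope classical_set_scope.
Local Open Scope ring_scope.

(* All the tensors involve vertical derivatives only, so the computation takes
   place in one tangent space, read in a chart as 'rV_n minus the origin.  With
   s = b / F and sigma_v = (B_v - s F_v) / F, the vertical derivative of s, the
   golden metric G = F (s^2 - s - 1) satisfies
     G_v = - (s^2 + 1) F_v + (2 s - 1) B_v,
     G_vw = - (s^2 + 1) F_vw + 2 F sigma_v sigma_w,
   since B_v has zero vertical derivative.  Euler's identities turn ell into F_v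
   and F^-1 hbar into F_vw, and both formulas become rational identities in the
   jets of F and B.  In (b) the left-hand side differentiates along X and the
   right-hand side along Z; the third-order terms nevertheless match as they
   stand, and the symmetry of the Hessian of F is the only commutation needed. *)

(** * Derivatives of composites with affine maps *)

Lemma derive_comp_line (R : realType) (V' V W : normedModType R) (A : V' -> V)
    (w : V) (v y : V') (f : V -> W) :
  (forall t : R, A (y + t *: v) = A y + t *: w) ->
  'D_v (f \o A) y = 'D_w f (A y).
Proof.
move=> Av; rewrite /derive; congr (lim (_ @ 0^')); apply/funext => t /=.
by rewrite (addrC _ y) Av (addrC (A y)).
Qed.

(** The induction closes because differentiating [f \o A] along [v] gives ['D_(L v) f \o A], again a
    composite with the same [A]. This restricts smoothness on the tangent bundle to a single
    fibre. *)
Lemma Ck_comp_affine (R : realType) (V' V W : normedModType R) (A : V' -> V)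
    (L : V' -> V) (U : set V) :
  (forall y, differentiable A y) ->
  (forall y v (t : R), A (y + t *: v) = A y + t *: L v) ->
  forall k (f : V -> W), Ck k U f -> Ck k (A @^-1` U) (f \o A).
Proof.
move=> dA AL; elim=> [|k IHk] f /=.
  move=> fC y Uy; apply: (@continuous_comp _ _ _ A f y _ (fC _ Uy)).
  exact: differentiable_continuous (dA y).
case=> fd fC; split=> [y Uy|v].
  by apply: differentiable_comp => //; exact: fd.
have -> : 'D_v (f \o A) = ('D_(L v) f) \o A.
  by apply/funext => y; rewrite (derive_comp_line (w := L v)).
exact: IHk.
Qed.

(** * Symmetry of mixed directional derivatives *)

Section Schwarz.
Context {R : realType} {V : normedModType R}.
Implicit Types (f : V -> R) (v w x : V).

Lemma is_derive_line f x v (s : R) : derivable f (x + s *: v) v ->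
  is_derive s 1 (fun t : R => f (x + t *: v)) ('D_v f (x + s *: v)).
Proof.
move=> df.
have E : (fun h : R => h^-1 *: (((fun t : R => f (x + t *: v)) \o shift s) (h *: (1 : R)) -
         f (x + s *: v))) =
   (fun h : R => h^-1 *: ((f \o shift (x + s *: v)) (h *: v) - f (x + s *: v))).
  apply/funext => h /=; congr (_ *: (f _ - _)).
  by rewrite -[h *: (1:R)]/(h * 1) mulr1 scalerDl addrCA.
by split; rewrite /derivable /derive E.
Qed.

Lemma MVT_line f x v (t : R) : 0 < t ->
  (forall s, 0 <= s <= t -> derivable f (x + s *: v) v) ->
  exists2 s, 0 <= s <= t & f (x + t *: v) - f x = t * 'D_v f (x + s *: v).
Proof.
move=> t0 df.
have dg s : 0 <= s <= t ->
    is_derive s 1 (fun t : R => f (x + t *: v)) ('D_v f (x + s *: v)).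
  by move=> /df; exact: is_derive_line.
have [|c|c] := @MVT R (fun t : R => f (x + t *: v))
    (fun s => 'D_v f (x + s *: v)) 0 t t0.
- by move=> s; rewrite in_itv /= => /andP[s0 st]; apply: dg; rewrite !ltW.
- apply: continuous_in_subspaceT => s; rewrite inE /= in_itv /= => /dg [ds _].
  by apply: differentiable_continuous; apply/derivable1_diffP.
rewrite in_itv /= => /andP[c0 ct]; rewrite scale0r addr0 subr0 => ->.
by exists c; [rewrite (ltW c0) (ltW ct) | rewrite [RHS]mulrC].
Qed.

(** The mean value theorem is used twice: along [v] for the increment [g z = f (z + t *: w) - f z],
    then along [w] for ['D_v f]. *)
Lemma second_difference f x v w (t : R) : 0 < t ->
  (forall s r, 0 <= s <= t -> 0 <= r <= t ->
     derivable f (x + s *: v + r *: w) v /\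
     derivable ('D_v f) (x + s *: v + r *: w) w) ->
  exists s r, [/\ 0 <= s <= t, 0 <= r <= t &
    f (x + t *: v + t *: w) - f (x + t *: v) - f (x + t *: w) + f x
    = t * (t * 'D_w ('D_v f) (x + s *: v + r *: w))].
Proof.
move=> t0 df.
have t1 : 0 <= t <= t by rewrite lexx ltW.
have o0 : 0 <= (0:R) <= t by rewrite lexx ltW.
pose g := (f \o shift (t *: w)) - f.
have dg s : 0 <= s <= t -> is_derive (x + s *: v) v g
    ('D_v f (x + s *: v + t *: w) - 'D_v f (x + s *: v)).
  move=> st; apply: is_deriveB; last first.
    by apply: derivableP; have [] := df s 0 st o0; rewrite scale0r addr0.
  have [d1 _] := df s t st t1.
  have E : (fun h : R => h^-1 *: (((f \o shift (t *: w)) \o shift (x + s *: v)) (h *: v) -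
         (f \o shift (t *: w)) (x + s *: v))) =
   (fun h : R => h^-1 *: ((f \o shift (x + s *: v + t *: w)) (h *: v) - f (x + s *: v + t *: w))).
    by apply/funext => h /=; rewrite !addrA.
  by split; rewrite /derivable /derive E.
have [s st Es] := @MVT_line g x v t t0 (fun s st => @ex_derive _ _ _ _ _ _ _ (dg s st)).
have [r rt Er] := @MVT_line ('D_v f) (x + s *: v) w t t0 (fun r rt => (df s r st rt).2).
exists s, r; split=> //; rewrite -Er -(@derive_val _ _ _ _ _ _ _ (dg s st)) -Es /g.
by rewrite -![(_ - _ : V -> R) _]/(_ - _) /=; ring.
Qed.

(** The second difference is symmetric in [v] and [w]. Expanding it in both orders and cancelling
    [t] twice equates the two mixed derivatives at two points of a small parallelogram at [x];
    continuity at [x] then bounds their difference at [x] by any [e > 0]. *)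
Lemma schwarz f x v w (U : set V) : open U -> U x ->
  (forall z, U z -> [/\ derivable f z v, derivable f z w,
     derivable ('D_v f) z w & derivable ('D_w f) z v]) ->
  {for x, continuous ('D_w ('D_v f))} -> {for x, continuous ('D_v ('D_w f))} ->
  'D_w ('D_v f) x = 'D_v ('D_w f) x.
Proof.
move=> Uo Ux df cwv cvw.
apply/eqP; rewrite -subr_eq0 -normr_le0; apply/ler_addgt0Pr => /= e e0.
rewrite add0r.
have e20 : 0 < e / 2 by rewrite divr_gt0.
have near_eq (a b p q : R) :
    p = q -> `|a - p| < e / 2 -> `|b - q| < e / 2 -> `|a - b| <= e.
  move=> -> h1 h2; rewrite (splitr e) ltW //; apply: le_lt_trans (ltrD h1 h2).
  by rewrite [X in _ <= _ + X]distrC ler_distD.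
(* A property valid near [x] holds on the whole parallelogram spanned by [t *: v] and [t *: w] once
   [t > 0] is small. *)
have near_x (P : set V) : nbhs x P -> \forall t \near (0 : R)^'+,
   forall s r, 0 <= s <= t -> 0 <= r <= t -> P (x + s *: v + r *: w).
  move=> /nbhs_ballP[d /= d0 dP].
  (* The summand 1 keeps the divisor positive when [v] and [w] both vanish. *)
  have k0 : 0 < `|v| + `|w| + 1 by rewrite ltr_wpDl ?addr_ge0.
  near=> t => s r /andP[s0 st] /andP[r0 rt]; apply: dP.
  rewrite -ball_normE /= -addrA opprD addNKr normrN.
  have td : t * (`|v| + `|w| + 1) < d.
    rewrite -ltr_pdivlMr //; near: t; apply: nbhs_right_lt; exact: divr_gt0.
  apply: le_lt_trans td; apply: (le_trans (ler_normD _ _)); rewrite !normrZ.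
  rewrite !ger0_norm // !mulrDr.
  have := ler_wpM2r (normr_ge0 v) st; have := ler_wpM2r (normr_ge0 w) rt.
  lra.
have nU := near_x _ (open_nbhs_nbhs (conj Uo Ux)).
have c1 : \forall z \near x, `|'D_w ('D_v f) x - 'D_w ('D_v f) z| < e / 2.
  by move/cvgrPdist_lt : cwv => /(_ _ e20).
have c2 : \forall z \near x, `|'D_v ('D_w f) x - 'D_v ('D_w f) z| < e / 2.
  by move/cvgrPdist_lt : cvw => /(_ _ e20).
have {c1} n1 := near_x _ c1; have {c2} n2 := near_x _ c2.
have [t [[t0 tU] [t1 t2]]] :=
  filter_ex (filterI (filterI (nbhs_right_gt 0) nU) (filterI n1 n2)).
have [|s [r [st rt E1]]] := @second_difference f x v w t t0.
  move=> s r st rt; have [dv _ dvw _] := df _ (tU s r st rt).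
  exact: (conj dv dvw).
have [|r' [s' [rt' st' E2]]] := @second_difference f x w v t t0.
  move=> s' r' st' rt'; rewrite addrAC; have [_ dw _ dwv] := df _ (tU r' s' rt' st').
  exact: (conj dw dwv).
have E : 'D_w ('D_v f) (x + s *: v + r *: w) = 'D_v ('D_w f) (x + s' *: v + r' *: w).
  apply: (mulfI (lt0r_neq0 t0)); apply: (mulfI (lt0r_neq0 t0)).
  rewrite (addrAC x (s' *: v) (r' *: w)); apply: etrans (esym E1) (etrans _ E2).
  rewrite (addrAC x (t *: w) (t *: v)).
  by congr (_ + _); exact: addrAC.
exact: near_eq E (t1 _ _ st rt) (t2 _ _ st' rt').
Unshelve. all: by end_near. Qed.

End Schwarz.

(** * Differentiation rules for functions written pointwise *)

Section PointwiseRules.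
Context {R : realType} {V : normedModType R}.
Implicit Types (f g : V -> R) (x v : V).

Lemma is_derive_fctD f g x v (df dg : R) :
  is_derive x v f df -> is_derive x v g dg ->
  is_derive x v (fun y => f y + g y) (df + dg).
Proof. exact: is_deriveD. Qed.

Lemma is_derive_fctN f x v (df : R) :
  is_derive x v f df -> is_derive x v (fun y => - f y) (- df).
Proof. exact: is_deriveN. Qed.

Lemma is_derive_fctM f g x v (df dg : R) :
  is_derive x v f df -> is_derive x v g dg ->
  is_derive x v (fun y => f y * g y) (f x * dg + g x * df).
Proof. exact: is_deriveM. Qed.

Lemma is_derive_fctX f x v k (df : R) :
  is_derive x v f df ->
  is_derive x v (fun y => f y ^+ k) (k%:R * f x ^+ k.-1 * df).
Proof.
move=> fd; rewrite (_ : (fun y => f y ^+ k) = f ^+ k); first exact: is_deriveX.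
by apply/funext => y; rewrite fctE.
Qed.

Lemma is_derive_fctV f x v (df : R) : f x != 0 ->
  is_derive x v f df -> is_derive x v (fun y => (f y)^-1) (- df / f x ^+ 2).
Proof.
move=> fx0 [fd fe]; split; first exact: derivableV.
by rewrite deriveV // fe /GRing.scale /=; field.
Qed.

Lemma is_derive_near f g x v (df : R) (U : set V) : open U -> U x ->
  (forall y, U y -> f y = g y) -> is_derive x v g df -> is_derive x v f df.
Proof.
move=> Uo Ux fg; apply: near_eq_is_derive.
near=> y; apply/esym/fg; near: y; exact: open_nbhs_nbhs.
Unshelve. all: by end_near. Qed.

End PointwiseRules.

(* [apply:] would let the typeclass instances of the library solve the premises,
   with derivatives stated for unapplied functions. *)
Ltac derive_rules := repeat first
  [ eassumption
  | notypeclasses refine (@is_derive_cst _ _ _ _ _ _)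
  | notypeclasses refine (@is_derive_fctD _ _ _ _ _ _ _ _ _ _)
  | notypeclasses refine (@is_derive_fctN _ _ _ _ _ _ _)
  | notypeclasses refine (@is_derive_fctM _ _ _ _ _ _ _ _ _ _)
  | notypeclasses refine (@is_derive_fctX _ _ _ _ _ _ _ _)
  | notypeclasses refine (@is_derive_fctV _ _ _ _ _ _ _ _) ].
(** The rules build the derivative as an existential variable, with context hypotheses as leaves and
    as nonvanishing conditions; the goal left over equates it with the announced value. *)
Ltac derive_calc :=
  notypeclasses refine (@is_derive_eq _ _ _ _ _ _ _ _ _ _); [derive_rules | ].

(** * The golden metric and its Cartan tensor on an open set of a normed space *)

Section GoldenCalculus.
Context {R : realType} {V : normedModType R} (U : set V).
Context (phi b : V -> R) (beta : V -> V -> R).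
Hypothesis Uo : open U.
Hypothesis phi0 : forall y, U y -> phi y != 0.
Hypothesis dphi : forall y v, U y -> derivable phi y v.
Hypothesis ddphi : forall y v w, U y -> derivable ('D_v phi) y w.
Hypothesis dddphi : forall y v w z, U y -> derivable ('D_w ('D_v phi)) y z.
Hypothesis hess_sym : forall y v w, U y ->
  'D_w ('D_v phi) y = 'D_v ('D_w phi) y.
Hypothesis euler1 : forall y, U y -> 'D_y phi y = phi y.
Hypothesis euler0 : forall y v, U y -> 'D_y ('D_v phi) y = 0.
Hypothesis db : forall y v, U y -> is_derive y v b (beta v y).
Hypothesis dbeta : forall y v w, U y -> is_derive y w (beta v) 0.

Implicit Types (y v w z X Y Z : V) (f : V -> R).

(** The metric tensor of [f] in linear fibre coordinates; [metric_fibre] makes the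
    identification. *)
Definition half_hess_sq f v w y : R := 2^-1 * 'D_v ('D_w (fun y => f y ^+ 2)) y.

Lemma half_hess_sqE f v w y :
  (forall y v, U y -> derivable f y v) ->
  (forall y v w, U y -> derivable ('D_v f) y w) -> U y ->
  half_hess_sq f v w y = f y * 'D_v ('D_w f) y + 'D_v f y * 'D_w f y.
Proof.
move=> df ddf Uy; rewrite /half_hess_sq.
have E : is_derive y v ('D_w (fun y => f y ^+ 2))
   (2 * (f y * 'D_v ('D_w f) y + 'D_v f y * 'D_w f y)).
  apply: (is_derive_near Uo Uy (g := fun y => 2 * f y * 'D_w f y)) => [z Uz|].
    have fz := derivableP (df z w Uz).
    by have -> := @derive_val _ _ _ _ _ _ _ (is_derive_fctX 2 fz); rewrite expr1.
  have fy := derivableP (df y v Uy); have dfy := derivableP (ddf y w v Uy).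
  by derive_calc; rewrite /=; ring.
by rewrite derive_val mulKf.
Qed.

Let s y := b y / phi y.
Let sigma v y := (beta v y - s y * 'D_v phi y) / phi y.
Let G y := b y ^+ 2 / phi y - phi y - b y.

Lemma is_derive_s y v : U y -> is_derive y v s (sigma v y).
Proof.
move=> Uy; have p0 := phi0 Uy.
have py := derivableP (@dphi y v Uy); have bv := @db y v Uy.
rewrite /s; derive_calc.
by rewrite /sigma /s; field.
Qed.

Lemma is_derive_golden y v : U y ->
  is_derive y v G (- (s y ^+ 2 + 1) * 'D_v phi y + (2 * s y - 1) * beta v y).
Proof.
move=> Uy; have p0 := phi0 Uy.
have py := derivableP (@dphi y v Uy); have bv := @db y v Uy.
rewrite /G; derive_calc.
by rewrite /sigma /s /=; field.
Qed.

(** Differentiating the two coefficients of ['D_v G] gives [2 sigma_w (beta_v - s phi_v)], and the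
    bracket is [phi sigma_v]. *)
Lemma is_derive2_golden y v w : U y ->
  is_derive y w ('D_v G)
    (- (s y ^+ 2 + 1) * 'D_w ('D_v phi) y + 2 * phi y * sigma w y * sigma v y).
Proof.
move=> Uy; have p0 := phi0 Uy.
apply: (is_derive_near Uo Uy
  (g := fun y => - (s y ^+ 2 + 1) * 'D_v phi y + (2 * s y - 1) * beta v y)).
  by move=> z Uz; have := @is_derive_golden z v Uz => -[].
have sy := @is_derive_s y w Uy; have bv := @dbeta y v w Uy.
have py := derivableP (@ddphi y v w Uy).
derive_calc.
by rewrite /sigma /=; field.
Qed.

(** Differentiate [phi sigma_v = beta_v - s phi_v], where [beta_v] has zero derivative. *)
Lemma is_derive_sigma y v w : U y -> is_derive y w (sigma v)
  (- (sigma w y * 'D_v phi y + s y * 'D_w ('D_v phi) y + sigma v y * 'D_w phi y)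
   / phi y).
Proof.
move=> Uy; have p0 := phi0 Uy.
have sy := @is_derive_s y w Uy; have bv := @dbeta y v w Uy.
have py := derivableP (@ddphi y v w Uy); have p1 := derivableP (@dphi y w Uy).
rewrite /sigma; derive_calc.
by rewrite /sigma /=; field.
Qed.

Lemma half_hess_sq_phi v w y : U y ->
  half_hess_sq phi v w y = phi y * 'D_v ('D_w phi) y + 'D_v phi y * 'D_w phi y.
Proof. by apply: half_hess_sqE => *; [exact: dphi | exact: ddphi]. Qed.

Lemma half_hess_sq_golden v w y : U y ->
  half_hess_sq G v w y =
    G y * (- (s y ^+ 2 + 1) * 'D_v ('D_w phi) y + 2 * phi y * sigma v y * sigma w y)
    + (- (s y ^+ 2 + 1) * 'D_v phi y + (2 * s y - 1) * beta v y)
      * (- (s y ^+ 2 + 1) * 'D_w phi y + (2 * s y - 1) * beta w y).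
Proof.
move=> Uy.
have dG z v' : U z -> derivable G z v'.
  by move=> Uz; have [] := @is_derive_golden z v' Uz.
have ddG z v' w' : U z -> derivable ('D_v' G) z w'.
  by move=> Uz; have [] := @is_derive2_golden z v' w' Uz.
have e1 := @derive_val _ _ _ _ _ _ _ (@is_derive2_golden y w v Uy).
have e2 := @derive_val _ _ _ _ _ _ _ (@is_derive_golden y v Uy).
have e3 := @derive_val _ _ _ _ _ _ _ (@is_derive_golden y w Uy).
apply: etrans (half_hess_sqE v w dG ddG Uy) _.
congr (_ * _ + _ * _); [exact: e1 | exact: e2 | exact: e3].
Qed.

Let ell v y := (phi y)^-1 * half_hess_sq phi y v y.
Let angular v w y := half_hess_sq phi v w y - ell v y * ell w y.
Let c1 y := (b y ^+ 2 + phi y ^+ 2) * (- b y ^+ 2 + b y * phi y + phi y ^+ 2)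
  / phi y ^+ 4.
Let c2 y := (phi y ^+ 3 - 4 * b y ^+ 3 + 3 * b y ^+ 2 * phi y) / phi y ^+ 3.
Let c3 y := (6 * b y ^+ 2 - 6 * b y * phi y - phi y ^+ 2) / phi y ^+ 2.

Lemma ellE v y : U y -> ell v y = 'D_v phi y.
Proof.
move=> Uy; have p0 := phi0 Uy.
by rewrite /ell half_hess_sq_phi // euler0 // euler1 // mulr0 add0r mulKf.
Qed.

Lemma angularE v w y : U y -> angular v w y = phi y * 'D_v ('D_w phi) y.
Proof. by move=> Uy; rewrite /angular !ellE // half_hess_sq_phi // addrK. Qed.

(** Write [G = phi q] with [q = s^2 - s - 1]. In the Hessian formula the coefficient of [angular] is
    [- q (s^2 + 1) = c1], that of [beta_v beta_w] is [2 q + (2 s - 1)^2 = c3], the mixed one is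
    [- 2 s q - (2 s - 1) (s^2 + 1) = c2], and that of [ell_v ell_w] is
    [2 s^2 q + (s^2 + 1)^2 = c1 - s c2]. *)
Lemma golden_metric v w y : U y ->
  half_hess_sq G v w y = c1 y * half_hess_sq phi v w y
    - b y / phi y * c2 y * (ell v y * ell w y) + c3 y * (beta v y * beta w y)
    + c2 y * (beta v y * ell w y + beta w y * ell v y).
Proof.
move=> Uy; have p0 := phi0 Uy.
rewrite half_hess_sq_golden // !ellE // half_hess_sq_phi // /G /sigma /s /c1 /c2 /c3.
by field.
Qed.

Lemma is_derive_half_hess_sq_phi v w z y : U y ->
  is_derive y z (half_hess_sq phi v w)
    (phi y * 'D_z ('D_v ('D_w phi)) y + 'D_v ('D_w phi) y * 'D_z phi y
     + ('D_v phi y * 'D_z ('D_w phi) y + 'D_w phi y * 'D_z ('D_v phi) y)).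
Proof.
move=> Uy; apply: (is_derive_near Uo Uy
  (g := fun y => phi y * 'D_v ('D_w phi) y + 'D_v phi y * 'D_w phi y)).
  by move=> x Ux; exact: half_hess_sq_phi.
have := derivableP (@dddphi y w v z Uy); have := derivableP (@dphi y z Uy).
have := derivableP (@ddphi y v z Uy); have := derivableP (@ddphi y w z Uy).
by move=> ? ? ? ?; derive_calc.
Qed.

(** Leibniz rule on [half_hess_sq_golden]; in the derivative of [2 phi sigma_Y sigma_Z] the factor
    [phi] cancels the denominators coming from [is_derive_sigma]. *)
Lemma is_derive_half_hess_sq_golden X Y Z y : U y ->
  is_derive y X (half_hess_sq G Y Z)
    ((- (s y ^+ 2 + 1) * 'D_X phi y + (2 * s y - 1) * beta X y)
      * (- (s y ^+ 2 + 1) * 'D_Y ('D_Z phi) y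
         + 2 * phi y * sigma Y y * sigma Z y)
     + G y * (- (s y ^+ 2 + 1) * 'D_X ('D_Y ('D_Z phi)) y
         - 2 * s y * sigma X y * 'D_Y ('D_Z phi) y
         + 2 * ('D_X phi y * sigma Y y * sigma Z y
           - (sigma X y * 'D_Y phi y + s y * 'D_X ('D_Y phi) y
              + sigma Y y * 'D_X phi y) * sigma Z y
           - (sigma X y * 'D_Z phi y + s y * 'D_X ('D_Z phi) y
              + sigma Z y * 'D_X phi y) * sigma Y y))
     + (- (s y ^+ 2 + 1) * 'D_X ('D_Y phi) y + 2 * phi y * sigma X y * sigma Y y)
      * (- (s y ^+ 2 + 1) * 'D_Z phi y + (2 * s y - 1) * beta Z y)
     + (- (s y ^+ 2 + 1) * 'D_X ('D_Z phi) y + 2 * phi y * sigma X y * sigma Z y)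
      * (- (s y ^+ 2 + 1) * 'D_Y phi y + (2 * s y - 1) * beta Y y)).
Proof.
move=> Uy; have p0 := phi0 Uy.
apply: (is_derive_near Uo Uy (fun x Ux => half_hess_sq_golden Y Z Ux)).
have dG := @is_derive_golden y X Uy; have dp := derivableP (@dphi y X Uy).
have ds := @is_derive_s y X Uy.
have dsY := @is_derive_sigma y Y X Uy; have dsZ := @is_derive_sigma y Z X Uy.
have dY := derivableP (@ddphi y Y X Uy); have dZ := derivableP (@ddphi y Z X Uy).
have bY := @dbeta y Y X Uy; have bZ := @dbeta y Z X Uy.
have dYZ := derivableP (@dddphi y Z Y X Uy).
derive_calc.
rewrite /G /sigma /s /=.
move: ('D_X ('D_Y ('D_Z phi)) y) ('D_Y ('D_Z phi) y) ('D_X ('D_Z phi) y)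
  ('D_X ('D_Y phi) y) ('D_X phi y) ('D_Y phi y) ('D_Z phi y) => *.
by field.
Qed.

(** The right-hand side is symmetric in spite of its form. Its [angular] terms outside the metric of
    [phi] combine to [c2 (sigma_X angular(Y,Z) + sigma_Y angular(X,Z))]. As a function of [s], [c1]
    has derivative [c2], so ['D_Z c1] supplies the third term [c2 sigma_Z angular(X,Y)]. All that
    remains besides the Cartan tensor of [phi] is [(12 s - 6) phi^2 sigma_X sigma_Y sigma_Z]. *)
Lemma golden_cartan X Y Z y : U y ->
  2 * (2^-1 * 'D_X (half_hess_sq G Y Z) y) =
    2 * c1 y * (2^-1 * 'D_X (half_hess_sq phi Y Z) y)
    - b y * c2 y / phi y ^+ 2
      * (angular X Z y * ell Y y + angular Y Z y * ell X y)
    + c2 y / phi y * (beta X y * angular Y Z y + beta Y y * angular X Z y)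
    + 'D_Z c1 y * half_hess_sq phi X Y y
    + 'D_Z c3 y * (beta X y * beta Y y)
    - 'D_Z (fun x => b x / phi x * c2 x) y * (ell X y * ell Y y)
    + 'D_Z c2 y * (beta X y * ell Y y + beta Y y * ell X y).
Proof.
move=> Uy; have p0 := phi0 Uy.
have e1 := @derive_val _ _ _ _ _ _ _ (@is_derive_half_hess_sq_golden X Y Z y Uy).
have e2 := @derive_val _ _ _ _ _ _ _ (@is_derive_half_hess_sq_phi Y Z X y Uy).
have dp := derivableP (@dphi y Z Uy); have dbZ := @db y Z Uy.
(* These discharge the conditions on the denominators of [c3], [c2] and [c1] when the rules below
   are applied. *)
have p2 : phi y ^+ 2 != 0 by rewrite expf_neq0.
have p3 : phi y ^+ 3 != 0 by rewrite expf_neq0.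
have p4 : phi y ^+ 4 != 0 by rewrite expf_neq0.
(* The coefficients are polynomials in [s]: [c1 = - s^4 + s^3 + s + 1], [c2 = 1 + 3 s^2 - 4 s^3],
   [c3 = 6 s^2 - 6 s - 1]. Each derivative is that of the polynomial times [sigma_Z]. *)
have d1 : is_derive y Z c1 ((- 4 * s y ^+ 3 + 3 * s y ^+ 2 + 1) * sigma Z y).
  by rewrite /c1; derive_calc; rewrite /sigma /s /=; field.
have d2 : is_derive y Z c2 ((6 * s y - 12 * s y ^+ 2) * sigma Z y).
  by rewrite /c2; derive_calc; rewrite /sigma /s /=; field.
have d3 : is_derive y Z c3 ((12 * s y - 6) * sigma Z y).
  by rewrite /c3; derive_calc; rewrite /sigma /s /=; field.
have d4 : is_derive y Z (fun x => b x / phi x * c2 x)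
   ((1 - 16 * s y ^+ 3 + 9 * s y ^+ 2) * sigma Z y).
  have ds := @is_derive_s y Z Uy.
  by derive_calc; rewrite /c2 /sigma /s /=; field.
have {d1} d1 := @derive_val _ _ _ _ _ _ _ d1.
have {d2} d2 := @derive_val _ _ _ _ _ _ _ d2.
have {d3} d3 := @derive_val _ _ _ _ _ _ _ d3.
have {d4} d4 := @derive_val _ _ _ _ _ _ _ d4.
rewrite e1 e2 d1 d2 d3 d4 !angularE // !ellE // half_hess_sq_phi //.
rewrite /c1 /c2 /c3 /G /sigma /s.
have hXY := @hess_sym y X Y Uy; have hXZ := @hess_sym y X Z Uy.
have hYZ := @hess_sym y Y Z Uy.
move: hXY hXZ hYZ {e1 e2 d1 d2 d3 d4}.
(* The jets of [phi] become scalar variables; [subst] then uses the Hessian symmetries to keep one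
   variable for each unordered pair of directions. *)
move: ('D_X ('D_Y ('D_Z phi)) y) ('D_Y ('D_Z phi) y) ('D_X ('D_Z phi) y)
  ('D_X ('D_Y phi) y) ('D_Z ('D_Y phi) y) ('D_Z ('D_X phi) y)
  ('D_Y ('D_X phi) y) ('D_X phi y) ('D_Y phi y) ('D_Z phi y).
move=> T hyz hxz hxy hzy hzx hyx lx ly lz ? ? ?; subst.
by field.
Qed.

End GoldenCalculus.

(** * Euler identities for positively homogeneous functions *)

Section Euler.
Context {R : realType} {V : normedModType R}.
Implicit Types (f : V -> R) (y v : V).

Lemma is_derive_of_line f y v (d : R) :
  is_derive (0 : R) 1 (fun t : R => f (y + t *: v)) d -> is_derive y v f d.
Proof.
have E : (fun h : R => h^-1 *: (((fun t : R => f (y + t *: v)) \o shift 0) (h *: (1 : R)) -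
         f (y + 0 *: v))) =
   (fun h : R => h^-1 *: ((f \o shift y) (h *: v) - f y)).
  apply/funext => h /=; rewrite scale0r !addr0 (addrC y).
  by rewrite -[h *: (1 : R)]/(h * 1) mulr1.
by case; rewrite /derivable /derive E => df dE; split.
Qed.

(** Along the ray [y + t *: y = (1 + t) *: y], and [1 + t > 0] for [t] near 0, so [f] is locally
    constant there. *)
Lemma derive_homogeneous0 f y :
  (forall k : R, 0 < k -> f (k *: y) = f y) -> 'D_y f y = 0.
Proof.
move=> fk; suff [] : is_derive y y f 0 by [].
apply: is_derive_of_line.
have D : is_derive (0 : R) 1 (fun=> f y) (0 : R) by exact: is_derive_cst.
apply: (near_eq_is_derive _ D).
near=> t; have t0 : 0 < 1 + t.
  by rewrite -ltrBlDl sub0r; near: t; apply: lt_nbhsr; rewrite ltrN10.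
have := fk _ t0; rewrite scalerDl scale1r => e; exact: (esym e).
Unshelve. all: by end_near. Qed.

Lemma derive_homogeneous1 f y :
  (forall k : R, 0 < k -> f (k *: y) = k * f y) -> 'D_y f y = f y.
Proof.
move=> fk; suff [] : is_derive y y f (f y) by [].
apply: is_derive_of_line.
have D : is_derive (0 : R) 1 (fun t : R => (1 + t) * f y) (f y).
  have D1 : is_derive (0 : R) 1 (fun=> 1 : R) (0 : R) by exact: is_derive_cst.
  have Df : is_derive (0 : R) 1 (fun=> f y) (0 : R) by exact: is_derive_cst.
  have Di : is_derive (0 : R) 1 (fun t : R => t) (1 : R) by exact: is_derive_id.
  have := is_derive_fctM (is_derive_fctD D1 Di) Df.
  by rewrite mulr0 !add0r mulr1.
apply: (near_eq_is_derive _ D).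
near=> t; have t0 : 0 < 1 + t.
  by rewrite -ltrBlDl sub0r; near: t; apply: lt_nbhsr; rewrite ltrN10.
have := fk _ t0; rewrite scalerDl scale1r => e; exact: (esym e).
Unshelve. all: by end_near. Qed.

(** The derivative of [z |-> f (k *: z)] is [k * 'D_v f (k *: y)] by the chain rule and
    [k * 'D_v f y] by homogeneity; [k] cancels. *)
Lemma homogeneous1_derive f y v (k : R) : 0 < k ->
  (forall z, f (k *: z) = k * f z) ->
  differentiable f y -> differentiable f (k *: y) ->
  'D_v f (k *: y) = 'D_v f y.
Proof.
move=> k0 fk df dfk.
have E1 : 'D_v (f \o ( *:%R k)) y = k * 'D_v f (k *: y).
  rewrite (derive_comp_line (w := k *: v)).
    by rewrite !deriveE // linearZ.
  by move=> t; rewrite scalerDr !scalerA mulrC.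
have E2 : 'D_v (f \o ( *:%R k)) y = k * 'D_v f y.
  rewrite (_ : f \o _ = k \*: f); first by rewrite deriveZ //; exact: diff_derivable.
  by apply/funext => z /=; rewrite fk.
by apply: (mulfI (lt0r_neq0 k0)); rewrite -E1 E2.
Qed.

End Euler.

(** * Restriction of tensors on the tangent bundle to one fibre *)

Lemma differentiable_row_mx (R : realType) (m n : nat) (c : 'rV[R]_m) (y : 'rV[R]_n) :
  differentiable (row_mx c) y.
Proof.
pose L : {linear 'rV[R]_n -> 'rV[R]_(m + n)} := mulmxr (row_mx 0 1%:M).
have LE z : L z = row_mx 0 z by rewrite /= mul_mx_row mulmx0 mulmx1.
have -> : row_mx c = cst (row_mx c 0) + L.
  apply/funext => z; rewrite -[RHS]/(row_mx c 0 + L z) LE add_row_mx.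
  by rewrite addr0 add0r.
(* For a linear map continuity suffices. It is checked entrywise on balls: each entry of [L z] is 0
   or an entry of [z]. *)
apply: differentiableD => //; apply: linear_differentiable => u A.
move=> /nbhs_ballP[e /= e0 eA].
apply/nbhs_ballP; exists e => //= v [_ uv]; apply: eA; split=> // i j.
change (ball (L u i j) e (L v i j)); rewrite !LE !mxE.
by case: (fintype.split j) => k; [rewrite !mxE; exact: ballxx | exact: uv].
Qed.

(** Three orders are extracted because the Cartan tensor involves third vertical derivatives of
    [F]. *)
Lemma smooth_on_regular (R : realType) (V : normedModType R) (U : set V)
    (f : V -> R) : smooth_on U f ->
  [/\ forall y, U y -> differentiable f y,
      forall y v, U y -> differentiable ('D_v f) y &
      forall y v w, U y -> differentiable ('D_w ('D_v f)) y].
Proof.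
move=> /(_ 3%N) [f0 /= f1]; split => // [y v Uy|y v w Uy].
  exact: (f1 v).1.
exact: ((f1 v).2 w).1.
Qed.

Section FibreCoordinates.
Context {R : realType} {n : nat} {M : manifold R n} (x : M) (a : idx M).
Hypothesis xa : dom (atlas a) x.
Implicit Types (u : tangent x) (v w y z : 'rV[R]_n).

Let iota y : tangent x := tangent_of a x y.

Lemma tangent_compK u : iota (u a) = u.
Proof. by apply: (tangent_eq xa); rewrite tangent_ofK. Qed.

Lemma tangent_of_line y z (t : R) : iota (y + t *: z) = iota y + t *: iota z.
Proof.
apply: (tangent_eq xa); rewrite tangent_ofK //.
rewrite -[RHS]/((iota y : idx M -> 'rV[R]_n) a + t *: (iota z : idx M -> 'rV[R]_n) a).
by rewrite !tangent_ofK.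
Qed.

Lemma tangent_ofZ y (k : R) : iota (k *: y) = k *: iota y.
Proof.
apply: (tangent_eq xa); rewrite tangent_ofK //.
rewrite -[RHS]/(k *: (iota y : idx M -> 'rV[R]_n) a).
by rewrite !tangent_ofK.
Qed.

(** The chart is linear on the fibre, so the curve [u + t *: w] reads as a straight line in
    components. *)
Lemma vderivE (f : tangent x -> R) (u w : tangent x) :
  vderiv f u w = 'D_(w a) (fun y => f (iota y)) (u a).
Proof.
rewrite derive_line /vderiv; congr (derive1 _ 0); apply/funext => t.
by rewrite tangent_of_line !tangent_compK.
Qed.

(** The affine embedding of the fibre over [x] into natural coordinates, with the base coordinates
    frozen. *)
Let A y : 'rV[R]_(n + n) := row_mx (crd (atlas a) x) y.

Lemma base_of_fibre y : base_of a (A y) = x.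
Proof. by rewrite /base_of row_mxKl crdK. Qed.

Lemma nat_fun_fibre (f : tm_fun M) y : nat_fun a f (A y) = f x (iota y).
Proof. by rewrite /nat_fun /vect_of base_of_fibre row_mxKr. Qed.

Lemma nat_set_slit_fibre : A @^-1` nat_set a slit = [set y | y != 0].
Proof.
apply/seteqP; split=> y /=.
  case=> _; rewrite /vect_of base_of_fibre row_mxKr; apply: contra_notN => /eqP ->.
  by apply: (tangent_eq xa); rewrite tangent_ofK.
move=> y0; split; first by rewrite row_mxKl; exists x.
rewrite /vect_of base_of_fibre row_mxKr /slit /= => e.
by move: y0; rewrite -(@tangent_ofK _ _ _ a x y) // e eqxx.
Qed.

Lemma differentiable_fibre y : differentiable A y.
Proof. exact: differentiable_row_mx. Qed.

Lemma fibre_line y z (t : R) : A (y + t *: z) = A y + t *: row_mx 0 z.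
Proof. by rewrite /A scale_row_mx scaler0 add_row_mx addr0. Qed.

Lemma smooth_on_fibre (f : tm_fun M) :
  smooth_on (nat_set a slit) (nat_fun a f) ->
  smooth_on [set y | y != 0] (fun y => f x (iota y)).
Proof.
move=> sf k; rewrite -nat_set_slit_fibre.
have -> : (fun y => f x (iota y)) = nat_fun a f \o A.
  by apply/funext => y /=; rewrite nat_fun_fibre.
exact: (Ck_comp_affine differentiable_fibre fibre_line (sf k)).
Qed.

Lemma open_punctured : open [set y : 'rV[R]_n | y != 0].
Proof.
rewrite (_ : [set y | _] = ~` [set 0]).
  apply: closed_openC; apply: accessible_closed_set1.
  exact: hausdorff_accessible (@norm_hausdorff _ _).
by apply/seteqP; split=> y /= /eqP.
Qed.

Lemma metric_fibre (F : tm_fun M) (u w1 w2 : tangent x) :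
  metric F x u w1 w2
  = half_hess_sq (fun y => F x (iota y)) (w1 a) (w2 a) (u a).
Proof.
have E y : vderiv (fun v : tangent x => F x v ^+ 2) (iota y) w2
    = 'D_(w2 a) (fun y => F x (iota y) ^+ 2) y.
  by rewrite vderivE tangent_ofK.
rewrite /metric vderivE.
exact: (congr1 (fun f : 'rV_n -> R => 2^-1 * 'D_(w1 a) f (u a)) (funext E)).
Qed.

Lemma cartan_fibre (F : tm_fun M) (X Y Z : pi_field M) u :
  cartan F X Y Z x u
  = 2^-1 * 'D_((X x u) a) (half_hess_sq (fun y => F x (iota y)) ((Y x u) a) ((Z x u) a))
             (u a).
Proof.
have E y : metric F x (iota y) (Y x u) (Z x u)
    = half_hess_sq (fun y => F x (iota y)) ((Y x u) a) ((Z x u) a) y.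
  by rewrite metric_fibre tangent_ofK.
rewrite /cartan /berwald_tensor2 vderivE.
exact: (congr1 (fun f : 'rV_n -> R => 2^-1 * 'D_((X x u) a) f (u a)) (funext E)).
Qed.

Section FinslerFibre.
Variable F : tm_fun M.
Arguments F : clear implicits.
Hypothesis hF : finsler_metric F.

Let phi y := F x (iota y).
Let U := [set y : 'rV[R]_n | y != 0].

Lemma slit_iota y : U y -> slit x (iota y).
Proof.
move=> y0; rewrite /slit /= => e.
by move: y0; rewrite /U /= -(@tangent_ofK _ _ _ a x y) // -/(iota y) e eqxx.
Qed.

Lemma finsler_fibre_neq0 y : U y -> phi y != 0.
Proof.
by case: hF => _ _ _ [_ F0 _ _] /slit_iota Uy; rewrite gt_eqF //; exact: F0.
Qed.

Lemma finsler_fibre_smooth :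
  [/\ forall y, U y -> differentiable phi y,
      forall y v, U y -> differentiable ('D_v phi) y &
      forall y v w, U y -> differentiable ('D_w ('D_v phi)) y].
Proof.
case: hF => _ _ _ [sF _ _ _].
exact: (smooth_on_regular (smooth_on_fibre (sF a))).
Qed.

Lemma finsler_fibre_homogeneous y (k : R) : 0 < k -> phi (k *: y) = k * phi y.
Proof.
by case: hF => _ _ hom _ k0; rewrite /phi tangent_ofZ; exact: hom.
Qed.

Lemma finsler_fibre_euler1 y : 'D_y phi y = phi y.
Proof. by apply: derive_homogeneous1 => k; exact: finsler_fibre_homogeneous. Qed.

(** First derivatives of [phi] are homogeneous of degree 0. *)
Lemma finsler_fibre_euler0 y v : U y -> 'D_y ('D_v phi) y = 0.
Proof.
have [dphi _ _] := finsler_fibre_smooth.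
move=> Uy; apply: derive_homogeneous0 => k k0; apply: homogeneous1_derive => //.
- by move=> z; exact: finsler_fibre_homogeneous.
- exact: dphi.
- by apply: dphi; rewrite /U /= scaler_eq0 negb_or (gt_eqF k0).
Qed.

Lemma finsler_fibre_hess_sym y v w : U y -> 'D_w ('D_v phi) y = 'D_v ('D_w phi) y.
Proof.
have [dphi ddphi dddphi] := finsler_fibre_smooth.
move=> Uy; apply: (@schwarz _ _ phi y v w U) => //.
- exact: open_punctured.
- move=> z Uz; split; apply: diff_derivable;
    [exact: dphi | exact: dphi | exact: ddphi | exact: ddphi].
- exact: differentiable_continuous (dddphi y v w Uy).
- exact: differentiable_continuous (dddphi y w v Uy).
Qed.

End FinslerFibre.

Section FormFibre.
Variable B : pi_form M.
Arguments B : clear implicits.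
Hypotheses (hB : pi_form_smooth slit B) (hBy : independent_of_y B).

Let beta z y := B x (iota y) (iota z).
Let U := [set y : 'rV[R]_n | y != 0].

(** Independence of [y] gives the value of the derivative, tested on fields with constant components
    in the chart [a]; its existence comes from the smoothness of [B]. *)
Lemma is_derive_form_fibre y z w : U y -> is_derive y w (beta z) 0.
Proof.
move=> Uy; have sb : smooth_on U (beta z).
  by have := @smooth_on_fibre
    (fun x' (u' : tangent x') => B x' u' (tangent_of a x' z)) (@hB a z).
have [db _ _] := smooth_on_regular sb.
split; first exact: diff_derivable (db y Uy).
have := hBy (fun x' _ => tangent_of a x' w) (fun x' _ => tangent_of a x' z)
  (slit_iota Uy).
rewrite /berwald_form vderivE !tangent_ofK //.
Qed.

(** [y] enters twice. Expanding the linear slot along [y + t *: v] isolates the term [t * beta v],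
    and the dependence through the base direction has zero derivative. *)
Lemma is_derive_frakB_fibre y v : U y ->
  is_derive y v (fun y => beta y y) (beta v y).
Proof.
move=> Uy; apply: is_derive_of_line.
have E : (fun t : R => beta (y + t *: v) (y + t *: v)) =
   (fun t => beta y (y + t *: v) + t * beta v (y + t *: v)).
  apply/funext => t; rewrite /beta {2}tangent_of_line.
  by rewrite raddfD /= linearZ.
rewrite E.
have line z : is_derive (0 : R) 1 (fun t : R => beta z (y + t *: v)) (0 : R).
  have [d e] := is_derive_form_fibre z v Uy.
  have e0 : y + (0 : R) *: v = y by rewrite scale0r addr0.
  have := @is_derive_line R _ (beta z) y v 0; rewrite e0 e; exact.
have Di : is_derive (0 : R) 1 (fun t : R => t) (1 : R) by exact: is_derive_id.
have := is_derive_fctD (line y) (is_derive_fctM Di (line v)).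
by rewrite mul0r mulr1 !add0r scale0r addr0.
Qed.

End FormFibre.

End FibreCoordinates.

(** * The formulas on the manifold, read in a chart *)

Theorem proposition3p7 (R : realType) (n : nat) (M : manifold R n)
  (F : tm_fun M) (B : pi_form M) (D : tm_set M)
  (hF : finsler_metric F)
  (hB : pi_form_smooth slit B)
  (hBy : independent_of_y B)
  (hG : conic_finsler_metric D (golden F B)) :
  let G := golden F B in
  let b := frakB B in
  let c1 := C1 F B in
  let c2 := C2 F B in
  let c3 := C3 F B in
  (forall (X Y : pi_field M) (x : M) (u : tangent x), D x u ->
     metric G x u (X x u) (Y x u) =
       c1 x u * metric F x u (X x u) (Y x u)
       - b x u / F x u * c2 x u * (ell F x u (X x u) * ell F x u (Y x u))
       + c3 x u * (B x u (X x u) * B x u (Y x u))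
       + c2 x u * (B x u (X x u) * ell F x u (Y x u)
                   + B x u (Y x u) * ell F x u (X x u)))
  /\
  (forall (X Y Z : pi_field M) (x : M) (u : tangent x), D x u ->
     2 * cartan G X Y Z x u =
       2 * c1 x u * cartan F X Y Z x u
       - b x u * c2 x u / F x u ^+ 2 *
           (angular F x u (X x u) (Z x u) * ell F x u (Y x u)
            + angular F x u (Y x u) (Z x u) * ell F x u (X x u))
       + c2 x u / F x u *
           (B x u (X x u) * angular F x u (Y x u) (Z x u)
            + B x u (Y x u) * angular F x u (X x u) (Z x u))
       + berwald_fun Z c1 x u * metric F x u (X x u) (Y x u)
       + berwald_fun Z c3 x u * (B x u (X x u) * B x u (Y x u))
       - berwald_fun Z (fun x' u' => b x' u' / F x' u' * c2 x' u') x u *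
           (ell F x u (X x u) * ell F x u (Y x u))
       + berwald_fun Z c2 x u *
           (B x u (X x u) * ell F x u (Y x u)
            + B x u (Y x u) * ell F x u (X x u))).
Proof.
case: hG => -[_ Dslit _] _ G b c1 c2 c3.
(* Since [D] lies in the slit bundle, the components of [u] land in the punctured space on which the
   fibre calculus is instantiated. *)
have chart_at (x : M) (u : tangent x) : D x u ->
    exists a, dom (atlas a) x /\ u a != 0.
  move=> /Dslit u0; have [a xa] := atlas_cover x; exists a; split=> //.
  by apply/eqP => ua0; apply: u0; exact: (@tangent_eq _ _ _ x a u 0 xa ua0).
split=> [X Y x u|X Y Z x u] /chart_at[a [xa ua0]].
- have [df ddf _] := finsler_fibre_smooth xa hF.
  have := @golden_metric R 'rV[R]_n [set y | y != 0]%classic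
    (fun y => F x (tangent_of a x y))
    (fun y => B x (tangent_of a x y) (tangent_of a x y))
    (fun z y => B x (tangent_of a x y) (tangent_of a x z))
    (@open_punctured R n) (@finsler_fibre_neq0 _ _ _ _ _ xa _ hF)
    (fun y v Uy => diff_derivable (df y Uy))
    (fun y v w Uy => diff_derivable (ddf y v Uy))
    (fun y _ => finsler_fibre_euler1 xa hF y)
    (fun y v Uy => finsler_fibre_euler0 xa hF v Uy)
    (fun y v Uy => is_derive_frakB_fibre xa hB hBy v Uy)
    (fun y v w Uy => is_derive_form_fibre xa hB hBy v w Uy)
    ((X x u) a) ((Y x u) a) (u a) ua0.
  rewrite /= !(tangent_compK xa) => E.
  by rewrite /ell !(metric_fibre xa) E.
- have [df ddf dddf] := finsler_fibre_smooth xa hF.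
  have := @golden_cartan R 'rV[R]_n [set y | y != 0]%classic
    (fun y => F x (tangent_of a x y))
    (fun y => B x (tangent_of a x y) (tangent_of a x y))
    (fun z y => B x (tangent_of a x y) (tangent_of a x z))
    (@open_punctured R n) (@finsler_fibre_neq0 _ _ _ _ _ xa _ hF)
    (fun y v Uy => diff_derivable (df y Uy))
    (fun y v w Uy => diff_derivable (ddf y v Uy))
    (fun y v w z Uy => diff_derivable (dddf y v w Uy))
    (fun y v w Uy => finsler_fibre_hess_sym xa hF v w Uy)
    (fun y _ => finsler_fibre_euler1 xa hF y)
    (fun y v Uy => finsler_fibre_euler0 xa hF v Uy)
    (fun y v Uy => is_derive_frakB_fibre xa hB hBy v Uy)
    (fun y v w Uy => is_derive_form_fibre xa hB hBy v w Uy)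
    ((X x u) a) ((Y x u) a) ((Z x u) a) (u a) ua0.
  rewrite /= !(tangent_compK xa) => E.
  rewrite /angular /ell !(metric_fibre xa) !(cartan_fibre xa).
  rewrite /berwald_fun !(vderivE xa).
  exact: E.
Qed.
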